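(* Let $\Pi$ be a graph property hereditary under contractions and determined by $3$-connected components. Let $G_f$ be a fuzzy graph, with fuzzy contractions formed using a $t$-norm $T$, and fix $\alpha\in(0,1]$. If a set $F$ of edges satisfies \[ G_f^{(\alpha)}/F\in\Pi, \] then $(G_f/F)^{(\alpha)}\in\Pi$.
   Context: A fuzzy graph is a pair $G_f=(\mu_V,\mu_E)$ with node membership $\mu_V:V\to[0,1]$ and edge membership $\mu_E(u,v)\in[0,1]$ (undirected edges), with $\mu_E(u,v)\le\min\{\mu_V(u),\mu_V(v)\}$. For $\alpha\in(0,1]$ its $\alpha$-cut is the crisp (ordinary) graph $G_f^{(\alpha)}$ with vertex set $\{v:\mu_V(v)\ge\alpha\}$ and edges $uv$ with $\mu_E(uv)\ge\alpha$. Fuzzy contraction: for an edge $e=uv$, $G_f/e$ has node set $(V\setminus\{u,v\})\cup\{w\}$, with $\mu(w)=\min\{\mu_V(u),\mu_V(v)\}$ (or an appropriate $t$-norm of these two values), and $\mu'_E(wx)=T(\mu_E(ux),\mu_E(vx))$ for every $x\in V\setminus\{u,v\}$, where $T:[0,1]^2\to[0,1]$ is a $t$-norm (commonly the minimum); all other memberships are unchanged. Crisp contraction: for a crisp graph $H$ and $e=uv$, $H/e$ is obtained by merging $u,v$ into one node $w$, where $w$ is adjacent to $x\notin\{u,v\}$ if and only if $x$ is adjacent in $H$ to both $u$ and $v$; all other adjacencies are unchanged (this is the fuzzy rule applied to $\{0,1\}$-valued memberships). For a set $F$ of edges, $G_f/F$ and $H/F$ denote the results of contracting the edges of $F$ one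 after another. A graph property is hereditary under contractions if it is preserved by contracting edges; it is determined by $3$-connected components if a graph has the property if and only if all its $3$-connected components have it. *)

(* Defs.v *)
From HB Require Import structures.
From mathcomp Require Import all_boot all_order all_algebra.
From mathcomp Require Import reals.
From Stdlib Require List.

Set Implicit Arguments.
Unset Strict Implicit.
Unset Printing Implicit Defensive.

Import Order.TTheory GRing.Theory Num.Theory.
Local Open Scope ring_scope.

Record sgraph := SGraph {
  vertex :> finType;
  adj : rel vertex;
  adj_sym : symmetric adj;
  adj_irr : irreflexive adj }.

Definition sgraph_iso (H K : sgraph) : Prop :=
  exists2 f : H -> K, bijective f & forall x y, adj (f x) (f y) = adj x y.

Definition graph_property (Pi : sgraph -> Prop) : Prop :=
  forall H K : sgraph, sgraph_iso H K -> Pi H -> Pi K.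

Definition edges (H : sgraph) : {set {set H}} :=
  [set [set p.1; p.2] | p : H * H & adj p.1 p.2].

(* The node set (V \ {u, v}) U {w}; the new node w is None. *)
Definition merged (V : finType) (u v : V) : finType :=
  option {x : V | x \notin [set u; v]}.

(* The quotient map: u and v go to None, any other x to Some x. *)
Definition merge (V : finType) (u v : V) : V -> merged u v := insub.

Section Contract.
Variables (H : sgraph) (u v : H).

Definition contract_adj (a b : merged u v) : bool :=
  match a, b with
  | Some x, Some y => adj (val x) (val y)
  | None, Some x | Some x, None => adj u (val x) && adj v (val x)
  | None, None => false
  end.

Fact contract_adj_sym : symmetric contract_adj.
Proof. by move=> [x|] [y|] //=; rewrite adj_sym. Qed.

Fact contract_adj_irr : irreflexive contract_adj.
Proof. by move=> [x|] //=; rewrite adj_irr. Qed.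

Definition contract : sgraph := SGraph contract_adj_sym contract_adj_irr.
End Contract.

(* The map c sends the original nodes to the nodes of the current graph H.  A
   pair whose ends have already been merged is skipped; a pair whose ends are
   still distinct is merged, even if an earlier step made them non-adjacent. *)
Fixpoint contract_along (V : Type) (s : seq (V * V)) (H : sgraph) (c : V -> H) :
    sgraph :=
  if s is (u, v) :: s' then
    if c u == c v then contract_along s' c
    else @contract_along V s' (contract (c u) (c v))
           (fun z => merge (c u) (c v) (c z))
  else H.

Definition contract_seq (H : sgraph) (s : seq (H * H)) : sgraph :=
  contract_along s (@id H).

(* s lists the members of the set F of unordered pairs, each exactly once. *)
Definition enumerates (V : finType) (s : seq (V * V)) (F : {set {set V}}) :=
  perm_eq [seq [set p.1; p.2] | p <- s] (enum F).

Definition contraction_hereditary (Pi : sgraph -> Prop) : Prop :=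
  forall (H : sgraph) (u v : H), adj u v -> Pi H -> Pi (contract u v).

Definition separation (H : sgraph) (A B : {set H}) : Prop :=
  [/\ A :|: B = [set: H], A :\: B != set0, B :\: A != set0 &
      forall x y, x \in A :\: B -> y \in B :\: A -> ~~ adj x y].

Section Torso.
Variables (H : sgraph) (A X : {set H}).

Definition torso_adj (x y : {z : H | z \in A}) : bool :=
  adj (val x) (val y) || [&& x != y, val x \in X & val y \in X].

Fact torso_adj_sym : symmetric torso_adj.
Proof. by move=> x y; rewrite /torso_adj adj_sym eq_sym [X in _ && X]andbC. Qed.

Fact torso_adj_irr : irreflexive torso_adj.
Proof. by move=> x; rewrite /torso_adj adj_irr eqxx. Qed.

(* H[A] together with the virtual edges joining the nodes of X. *)
Definition torso : sgraph := SGraph torso_adj_sym torso_adj_irr.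
End Torso.

(* [components3 H cs]: cs is obtained by splitting H completely into its
   3-connected components (Tutte, Hopcroft-Tarjan).  A graph is split at a
   separation of least order k <= 2: k = 0 separates connected components,
   k = 1 splits a connected graph at a cut vertex, and k = 2 splits a
   2-connected graph at a separation pair, adding the virtual edge to both
   sides.  The final pieces have no separation of order at most 2: they are
   K_1, K_2, K_3 and the 3-connected graphs on at least 4 nodes.  The list cs
   is unique up to order and isomorphism.  The empty graph has no components. *)
Inductive components3 : sgraph -> seq sgraph -> Prop :=
| Components3_empty (H : sgraph) :
    #|H| = 0%N -> components3 H [::]
| Components3_leaf (H : sgraph) :
    (0 < #|H|)%N ->
    (forall A B : {set H}, separation A B -> (2 < #|A :&: B|)%N) ->
    components3 H [:: H]
| Components3_split (H : sgraph) (A B : {set H}) (cs ds : seq sgraph) :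
    separation A B -> (#|A :&: B| <= 2)%N ->
    (forall A' B' : {set H},
        separation A' B' -> (#|A :&: B| <= #|A' :&: B'|)%N) ->
    components3 (torso A (A :&: B)) cs ->
    components3 (torso B (A :&: B)) ds ->
    components3 H (cs ++ ds).

Definition determined_by_components3 (Pi : sgraph -> Prop) : Prop :=
  forall (H : sgraph) (cs : seq sgraph),
    components3 H cs -> (Pi H <-> List.Forall Pi cs).

Definition in01 (R : realType) (a : R) : bool := 0 <= a <= 1.

Record tnorm (R : realType) := TNorm {
  tnorm_fun :> R -> R -> R;
  tnorm_in01 : forall a b, in01 a -> in01 b -> in01 (tnorm_fun a b);
  tnormC : forall a b, in01 a -> in01 b -> tnorm_fun a b = tnorm_fun b a;
  tnormA : forall a b c, in01 a -> in01 b -> in01 c ->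
    tnorm_fun a (tnorm_fun b c) = tnorm_fun (tnorm_fun a b) c;
  tnorm_mono : forall a b c, in01 a -> in01 b -> in01 c -> b <= c ->
    tnorm_fun a b <= tnorm_fun a c;
  tnorm1 : forall a, in01 a -> tnorm_fun a 1 = a }.

Definition tnorm_le (R : realType) (T S : tnorm R) : Prop :=
  forall a b, in01 a -> in01 b -> T a b <= S a b.

Section MinTnorm.
Variable R : realType.

Fact min_in01 (a b : R) : in01 a -> in01 b -> in01 (Num.min a b).
Proof. by move=> ha hb; case: leP. Qed.

Fact min_mono (a b c : R) : in01 a -> in01 b -> in01 c -> b <= c ->
  Num.min a b <= Num.min a c.
Proof. by move=> _ _ _ bc; rewrite le_min ge_min lexx ge_min bc orbT. Qed.

Fact min1 (a : R) : in01 a -> Num.min a 1 = a.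
Proof. by case/andP=> _ /min_idPl. Qed.

Definition tnorm_min : tnorm R :=
  @TNorm R Num.min min_in01 (fun a b _ _ => minC a b)
    (fun a b c _ _ _ => minA a b c) min_mono min1.

Fact in01_1 : in01 (1 : R).
Proof. by rewrite /in01 ler01 lexx. Qed.

Fact tnorm_le_min (T : tnorm R) : tnorm_le T tnorm_min.
Proof.
have le_l a b : in01 a -> in01 b -> T a b <= a.
  move=> ha hb; rewrite -[leRHS](tnorm1 T ha).
  by apply: tnorm_mono => //; [exact: in01_1 | case/andP: hb].
move=> a b ha hb /=; rewrite le_min le_l //=.
by rewrite (tnormC T) // le_l.
Qed.
End MinTnorm.

Fact tnorm_le_refl (R : realType) (T : tnorm R) : tnorm_le T T.
Proof. by move=> a b _ _; exact: lexx. Qed.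

Record fuzzy_graph (R : realType) := FuzzyGraph {
  fnode :> finType;
  muV : fnode -> R;
  muE : fnode -> fnode -> R;
  muV_in01 : forall x, in01 (muV x);
  muE_in01 : forall x y, in01 (muE x y);
  muE_sym : forall x y, muE x y = muE y x;
  muE_irr : forall x, muE x x = 0;
  muE_le : forall x y, muE x y <= Num.min (muV x) (muV y) }.

Section FuzzyContract.
(* T acts on the edge memberships and S on the memberships of the two merged
   nodes.  S is "appropriate" when T <= S, which is what makes the result a
   fuzzy graph again; S = tnorm_min (tnorm_le_min) and S = T (tnorm_le_refl)
   both qualify. *)
Variables (R : realType) (T S : tnorm R) (TS : tnorm_le T S).
Variables (G : fuzzy_graph R) (u v : G).

Definition fcontract_muV (a : merged u v) : R :=
  if a is Some x then muV (val x) else S (muV u) (muV v).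

Definition fcontract_muE (a b : merged u v) : R :=
  match a, b with
  | Some x, Some y => muE (val x) (val y)
  | None, Some x | Some x, None => T (muE u (val x)) (muE v (val x))
  | None, None => 0
  end.

Fact fcontract_muV_in01 a : in01 (fcontract_muV a).
Proof.
case: a => [x|] /=; first exact: muV_in01.
by apply: tnorm_in01; exact: muV_in01.
Qed.

Fact fcontract_muE_in01 a b : in01 (fcontract_muE a b).
Proof.
case: a b => [x|] [y|] /=; rewrite ?muE_in01 //;
  by [apply: tnorm_in01; exact: muE_in01 | rewrite /in01 lexx ler01].
Qed.

Fact fcontract_muE_sym a b : fcontract_muE a b = fcontract_muE b a.
Proof. by case: a b => [x|] [y|] //=; rewrite muE_sym. Qed.

Fact fcontract_muE_irr a : fcontract_muE a a = 0.
Proof. by case: a => [x|] //=; rewrite muE_irr. Qed.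

Fact tnorm_le2 (a b c d : R) :
  in01 a -> in01 b -> in01 c -> in01 d -> a <= c -> b <= d -> T a b <= T c d.
Proof.
move=> ha hb hc hd ac bd; apply: (@le_trans _ _ (T a d)).
  exact: tnorm_mono.
by rewrite (tnormC T ha hd) (tnormC T hc hd); exact: tnorm_mono.
Qed.

Fact muE_leV (x y : G) : (muE x y <= muV x) /\ (muE x y <= muV y).
Proof. by apply/andP; rewrite -le_min muE_le. Qed.

Fact fcontract_wx (x : G) :
  (T (muE u x) (muE v x) <= S (muV u) (muV v)) /\
  (T (muE u x) (muE v x) <= muV x).
Proof.
split.
  apply: (@le_trans _ _ (T (muV u) (muV v))); last by apply: TS; exact: muV_in01.
  by apply: tnorm_le2;
    rewrite ?muE_in01 ?muV_in01 ?(proj1 (muE_leV _ _)).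
have /= := @tnorm_le_min R T _ _ (muE_in01 u x) (muE_in01 v x).
rewrite le_min => /andP[h _]; exact: le_trans h (proj2 (muE_leV _ _)).
Qed.

Fact fcontract_muE_le a b :
  fcontract_muE a b <= Num.min (fcontract_muV a) (fcontract_muV b).
Proof.
case: a b => [x|] [y|] /=; rewrite ?muE_le // le_min.
- by have [-> ->] := fcontract_wx (val x).
- by have [-> ->] := fcontract_wx (val y).
- by have /andP[-> _] := fcontract_muV_in01 None.
Qed.

Definition fcontract : fuzzy_graph R :=
  FuzzyGraph fcontract_muV_in01 fcontract_muE_in01 fcontract_muE_sym
    fcontract_muE_irr fcontract_muE_le.
End FuzzyContract.

Fixpoint fcontract_along (R : realType) (T S : tnorm R) (TS : tnorm_le T S)
    (V : Type) (s : seq (V * V)) (G : fuzzy_graph R) (c : V -> G) :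
    fuzzy_graph R :=
  if s is (u, v) :: s' then
    if c u == c v then fcontract_along TS s' c
    else @fcontract_along R T S TS V s' (fcontract TS (c u) (c v))
           (fun z => merge (c u) (c v) (c z))
  else G.

Definition fcontract_seq (R : realType) (T S : tnorm R) (TS : tnorm_le T S)
    (G : fuzzy_graph R) (s : seq (G * G)) : fuzzy_graph R :=
  fcontract_along TS s (@id G).

Section Cut.
Variables (R : realType) (G : fuzzy_graph R) (alpha : R).

Definition cut_adj (x y : {z : G | alpha <= muV z}) : bool :=
  (x != y) && (alpha <= muE (val x) (val y)).

Fact cut_adj_sym : symmetric cut_adj.
Proof. by move=> x y; rewrite /cut_adj eq_sym muE_sym. Qed.

Fact cut_adj_irr : irreflexive cut_adj.
Proof. by move=> x; rewrite /cut_adj eqxx. Qed.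

Definition cut : sgraph := SGraph cut_adj_sym cut_adj_irr.

Definition cut_val (x : cut) : G := val x.
End Cut.

(* Main.v *)
Require Import Defs.
From HB Require Import structures.
From mathcomp Require Import all_boot all_order all_algebra.
From mathcomp Require Import reals.

Set Implicit Arguments.
Unset Strict Implicit.
Unset Printing Implicit Defensive.

Import Order.TTheory GRing.Theory Num.Theory.
Local Open Scope ring_scope.

(** Contracting with a t-norm never creates an edge of the cut that crisp
contraction lacks.  A t-norm lies below the minimum, so if the membership of
an edge of G/F reaches alpha, then so do the memberships of all the edges of G
between the two merged classes, and crisp contraction joins the two classes
exactly when all these edges are present.  Likewise a node of G/F that
survives the cut comes from a class of nodes that all survive it.  Hence the
cut of G/F is a subgraph of the contraction of the cut
([fcontract_along_quotient], [contract_along_quotient]): a strict t-norm may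
drop edges, and may drop merged nodes.

It remains to see that Pi is closed under arbitrary subgraphs ([Pi_subgraph]),
which is where the two hypotheses on Pi combine.  Deleting nodes reduces to
deleting edges, since an isolated node is a component of its own.  Let ab be an
edge of a 2-connected member H of Pi.  Replace ab by a path a-p-q-b:
the 3-connected components of the new graph are those of H together with two
triangles, so the new graph is in Pi as soon as the triangle is
([Pi_subdivide]).  Now contract pq.  Since p and q have no common neighbour,
the merged node is isolated, and what remains is H without ab, which is
therefore in Pi ([Pi_delete_two_connected]).  The general case follows by
splitting H at its separations of order at most 1 ([Pi_delete]).

The triangle is in Pi as soon as some member has at least two nodes, all of
which but at most one have degree at least 2 ([Pi_triangle]).  This condition
passes to one side of a separation of least order at most 2, and from a
3-connected graph on more than three nodes to each of its contractions, so one
can descend to a triangle. *)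

(** * Separations *)

Definition sepb (H : sgraph) (A B : {set H}) : bool :=
  [&& A :|: B == [set: H], A :\: B != set0, B :\: A != set0 &
      [forall x, forall y, (x \in A :\: B) ==> (y \in B :\: A) ==> ~~ adj x y]].

Lemma sepP (H : sgraph) (A B : {set H}) : reflect (separation A B) (sepb A B).
Proof.
apply: (iffP and4P) => -[h1 h2 h3 h4]; split => //; first exact/eqP.
- by move=> x y hx hy; move/forallP/(_ x)/forallP/(_ y): h4; rewrite hx hy.
- exact/eqP.
- apply/'forall_forallP => x y.
  by apply/implyP=> hx; apply/implyP=> hy; apply: h4.
Qed.

Lemma sep_intro (H : sgraph) (A B : {set H}) (a b : H) :
  (forall x, x \notin B -> x \in A) -> a \notin B -> b \notin A ->
  (forall x y, x \notin B -> y \notin A -> ~~ adj x y) -> separation A B.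
Proof.
move=> cov aB bA nadj; have cov' x : x \notin A -> x \in B.
  by move=> xA; apply/negPn/negP=> /cov; rewrite (negPf xA).
split; last by move=> x y /setDP[_ xB] /setDP[_ yA]; apply: nadj.
- apply/setP=> x; rewrite !inE.
  by case: (boolP (x \in A)) => // /cov'.
- by apply/set0Pn; exists a; rewrite inE aB cov.
- by apply/set0Pn; exists b; rewrite inE bA cov'.
Qed.

Lemma sepC (H : sgraph) (A B : {set H}) : separation A B -> separation B A.
Proof.
case=> h1 h2 h3 h4; split=> //; first by rewrite setUC.
by move=> x y hx hy; rewrite adj_sym; apply: h4.
Qed.

Lemma sep_cover (H : sgraph) (A B : {set H}) x :
  separation A B -> x \notin B -> x \in A.
Proof.
by case=> /setP/(_ x); rewrite !inE => + _ _ _ /negPf => + xB; rewrite xB orbF.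
Qed.

Lemma sep_left (H : sgraph) (A B : {set H}) :
  separation A B -> exists a, a \notin B.
Proof. by case=> _ /set0Pn[a /setDP[_ aB]] _ _; exists a. Qed.

Lemma sep_adj (H : sgraph) (A B : {set H}) x y :
  separation A B -> adj x y -> x \notin B -> y \in A.
Proof.
move=> sAB xy xB; apply/negPn/negP=> yA.
have xA := sep_cover sAB xB; have yB := sep_cover (sepC sAB) yA.
by case: sAB => _ _ _ /(_ x y); rewrite !inE xB xA yA yB xy => /(_ isT isT).
Qed.

(** Every separation has order at least [k]; for [k] = 1, 2, 3 this is
[k]-connectedness without the usual condition on the number of nodes. *)
Definition linked (k : nat) (H : sgraph) : Prop :=
  forall A B : {set H}, separation A B -> (k <= #|A :&: B|)%N.

(** Splitting a graph requires a separation of least order, so the failure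
of [linked k] has to provide one. *)
Lemma least_separation (k : nat) (H : sgraph) :
  linked k H \/ exists A B : {set H},
    [/\ separation A B, (#|A :&: B| < k)%N & linked #|A :&: B| H].
Proof.
pose P := [pred p : {set H} * {set H} | sepb p.1 p.2].
case: (pickP P) => [p0 Pp0|P0]; last first.
  by left=> A B /sepP; move: (P0 (A, B)) => /= ->.
pose order (p : {set H} * {set H}) := #|p.1 :&: p.2|.
have [[A B] /= /sepP sAB min] := @arg_minnP _ p0 P order Pp0.
have lAB : linked #|A :&: B| H by move=> C D /sepP sCD; apply: (min (C, D)).
have [ltk|lek] := ltnP #|A :&: B| k; first by right; exists A, B.
by left=> C D /lAB; apply: leq_trans.
Qed.

Lemma torso_proper (H : sgraph) (A B X : {set H}) :
  separation A B -> (#|torso A X| < #|H|)%N.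
Proof.
case/sepC/sep_left=> b bA; rewrite card_sig.
rewrite -[X in (_ < X)%N]cardsT -[#|[pred _ | _]|]/(#|A|) proper_card //.
by apply/properP; split; [exact: subsetT | exists b].
Qed.

Lemma components3_exist (H : sgraph) : exists cs, components3 H cs.
Proof.
have [n] := ubnP #|H|; elim: n H => // n IHn H; rewrite ltnS => leHn.
have [H0|] := posnP #|H|; first by exists [::]; apply: Components3_empty.
have [lH H_gt0|[A [B [sAB oAB lAB]]] _] := least_separation 3 H.
  by exists [:: H]; apply: Components3_leaf.
have [cs hcs] := IHn _ (leq_trans (torso_proper (A :&: B) sAB) leHn).
have [ds hds] := IHn _ (leq_trans (torso_proper (A :&: B) (sepC sAB)) leHn).
by exists (cs ++ ds); apply: (Components3_split sAB).
Qed.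

(** By minimality: otherwise [x] could be moved out of [B], which would lower
the order by one. *)
Lemma boundary_adj (H : sgraph) (A B : {set H}) x :
  separation A B -> linked #|A :&: B| H -> x \in A :&: B ->
  exists2 c, c \notin A & adj x c.
Proof.
move=> sAB lAB xAB.
have [c /andP[cA xc]|nx] := pickP (fun c => (c \notin A) && adj x c).
  by exists c.
have [a aB] := sep_left sAB; have [b bA] := sep_left (sepC sAB).
have /setIP[xA xB] := xAB.
suff /lAB : separation A (B :\ x).
  by rewrite setIDA (cardsD1 x (A :&: B)) xAB ltnn.
apply: (@sep_intro _ _ _ a b) => [y|||y z] //.
- rewrite !inE negb_and negbK => /orP[/eqP-> //|].
  exact: sep_cover.
- by rewrite !inE (negPf aB) andbF.
- rewrite !inE negb_and negbK => /orP[/eqP->|yB] zA.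
    by have := nx z; rewrite /= zA /= => ->.
  by apply: contra zA => /(sep_adj sAB); apply.
Qed.

(** The neighbours of [x] separate [x] from the other nodes, unless [x] is
adjacent to all of them. *)
Lemma linked_degree (k : nat) (H : sgraph) (x : H) :
  linked k H -> (k < #|H|)%N -> (k <= #|[set y | adj x y]|)%N.
Proof.
move=> lH ltkH; set N := [set y | adj x y].
have NI : (x |: N) :&: [set~ x] = N.
  apply/setP=> y; rewrite !inE; case: eqP => [->|_]; rewrite ?adj_irr //=.
  by rewrite andbT.
have [/existsP[y /andP[yx nxy]]|/existsPn all_adj] :=
  boolP [exists y, (y != x) && ~~ adj x y].
  rewrite -NI; apply: lH; apply: (@sep_intro _ _ _ x y) => [z|||z t].
  - by rewrite !inE negbK => ->.
  - by rewrite !inE eqxx.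
  - by rewrite !inE (negPf yx).
  - by rewrite !inE negbK negb_or => /eqP-> /andP[].
rewrite -ltnS; apply: leq_trans ltkH _.
rewrite -[#|H|]cardsT (cardsD1 x) inE add1n ltnS subset_leq_card //.
apply/subsetP=> y; rewrite !inE andbT => yx.
by move: (all_adj y); rewrite yx negbK.
Qed.

(** * Graph operations *)

Lemma adj_neq (H : sgraph) (x y : H) : adj x y -> x != y.
Proof. by apply: contraTneq => ->; rewrite adj_irr. Qed.

Lemma contract_proper (H : sgraph) (u v : H) :
  u != v -> (#|contract u v| < #|H|)%N.
Proof.
move=> uv; rewrite card_option card_sig.
have -> : #|[pred x | x \notin [set u; v]]| = #|~: [set u; v]|.
  by apply: eq_card => x; rewrite !inE.
have := cardsC [set u; v]; rewrite cards2 uv => <-.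
by rewrite addSn ltnS add1n.
Qed.

Definition complete_adj n (x y : 'I_n) : bool := x != y.

Fact complete_sym n : symmetric (@complete_adj n).
Proof. by move=> x y; rewrite /complete_adj eq_sym. Qed.

Fact complete_irr n : irreflexive (@complete_adj n).
Proof. by move=> x; rewrite /complete_adj eqxx. Qed.

Definition complete n : sgraph := SGraph (@complete_sym n) (@complete_irr n).

Definition same_edge (V : eqType) (a b x y : V) : bool :=
  (x == a) && (y == b) || (x == b) && (y == a).

Lemma same_edgeC (V : eqType) (a b x y : V) :
  same_edge a b x y = same_edge a b y x.
Proof. by rewrite /same_edge orbC andbC [X in _ || X]andbC. Qed.

Section EdgeOperations.
Variables (H : sgraph) (a b : H).

Definition delete_adj (x y : H) : bool := adj x y && ~~ same_edge a b x y.

Fact delete_sym : symmetric delete_adj.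
Proof. by move=> x y; rewrite /delete_adj adj_sym same_edgeC. Qed.

Fact delete_irr : irreflexive delete_adj.
Proof. by move=> x; rewrite /delete_adj adj_irr. Qed.

Definition delete : sgraph := SGraph delete_sym delete_irr.

Definition subdivide_adj (x y : option H) : bool :=
  match x, y with
  | Some x, Some y => delete_adj x y
  | None, Some x | Some x, None => (x == a) || (x == b)
  | None, None => false
  end.

Fact subdivide_sym : symmetric subdivide_adj.
Proof. by move=> [x|] [y|] //=; rewrite delete_sym. Qed.

Fact subdivide_irr : irreflexive subdivide_adj.
Proof. by move=> [x|] //=; rewrite delete_irr. Qed.

Definition subdivide : sgraph := SGraph subdivide_sym subdivide_irr.
End EdgeOperations.

Lemma separation_delete (H : sgraph) (a b : H) (A B : {set H}) :
  separation A B -> @separation (delete a b) A B.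
Proof.
case=> AB nA nB nadj; split=> // x y xA yB.
by rewrite /= /delete_adj negb_and nadj.
Qed.

(** A separation of order at most 1 of the subdivision induces one of [H].  The
delicate case is that the new node is the whole boundary: the two sides then
cut [H] along the edge ab only, and a side with at least two nodes yields a
separation whose boundary is one end of ab. *)
Lemma subdivide_linked (H : sgraph) (a b : H) :
  adj a b -> (2 < #|H|)%N -> linked 2 H -> linked 2 (subdivide a b).
Proof.
move=> ab H3 lH A B sAB; rewrite leqNgt; apply/negP=> oAB.
pose old (C : {set subdivide a b}) : {set H} := [set x | Some x \in C].
have cross C D x y : separation C D ->
    x \notin old D -> y \notin old C -> adj x y -> same_edge a b x y.
  rewrite !inE => sCD xD yC xy; apply: contraNT yC => nab.
  by apply: (sep_adj sCD) xD; rewrite /= /delete_adj xy.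
have cov C D x : separation C D -> x \notin old D -> x \in old C.
  by rewrite !inE; exact: sep_cover.
have [|mid] := boolP (None \in A :&: B).
  move=> midAB.
  have {}oAB x : x \in old A -> x \notin old B.
    rewrite !inE => xA; apply: contraTN oAB => xB; rewrite -leqNgt.
    by apply/card_gt1P; exists None, (Some x); split; rewrite // inE xA.
  wlog A2 : A B sAB midAB oAB / (1 < #|old A|)%N.
    move=> gen; have [A2|A1] := ltnP 1 #|old A|; first exact: (gen A B).
    apply: (gen B A); rewrite 1?setIC //; first exact: sepC.
      by move=> x; apply: contraTN; apply: oAB.
    have eB : ~: old A \subset old B.
      by apply/subsetP=> x; rewrite inE; apply: cov (sepC sAB).
    apply: leq_trans (subset_leq_card eB).
    rewrite -(ltn_add2l #|old A|) cardsC.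
    by apply: leq_trans H3; rewrite addn1 ltnS.
  (* The end of ab that lies in A, if there is one. *)
  pose e := if a \in old A then a else b.
  have [x xA xe] : exists2 x, x \in old A & x != e.
    case/card_gt1P: A2 => x [y [xA yA xy]].
    have [xe|] := eqVneq x e; last by exists x.
    by exists y; rewrite // -xe eq_sym.
  have [[y|] yA] := sep_left (sepC sAB); last first.
    by rewrite inE (negPf yA) in midAB.
  have sH : separation (old A) (e |: old B).
    apply: (@sep_intro _ _ _ x y) => [z|||z t].
    - by rewrite in_setU1 negb_or => /andP[_]; apply: cov sAB.
    - by rewrite in_setU1 negb_or xe oAB.
    - by rewrite inE.
    - rewrite in_setU1 negb_or => /andP[ze zB] tA.
      apply/negP=> /(cross _ _ _ _ sAB zB tA).
      case/orP=> /andP[/eqP zE /eqP tE]; move: ze; rewrite /e.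
        by rewrite -zE (cov _ _ _ sAB zB) eqxx.
      by rewrite -tE (negPf tA) -zE eqxx.
  have := lH _ _ sH; rewrite ltnNge -(cards1 e) subset_leq_card //.
  apply/subsetP=> z; rewrite in_setI in_setU1 in_set1 => /andP[zA].
  by rewrite (negPf (oAB _ zA)) orbF.
wlog midB : A B sAB oAB mid / None \notin B.
  move=> gen; have [midB|] := boolP (None \in B); last exact: (gen A B).
  apply: (gen B A); rewrite 1?setIC //; first exact: sepC.
  by move: mid; rewrite inE midB andbT.
have aA : a \in old A by rewrite inE (sep_adj sAB _ midB) //= eqxx.
have bA : b \in old A by rewrite inE (sep_adj sAB _ midB) //= eqxx orbT.
have oH : (#|old A :&: old B| < 2)%N.
  apply: leq_ltn_trans oAB; rewrite -(card_imset _ Some_inj).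
  apply/subset_leq_card/subsetP=> x /imsetP[y + ->].
  by rewrite !inE.
have [[y|] yA] := sep_left (sepC sAB); last first.
  by move: midB; rewrite (sep_cover (sepC sAB) yA).
have [/subsetP AB|/subsetPn[x xA xB]] := boolP (old A \subset old B).
  move: oH; rewrite ltnNge => /negP; apply; apply/card_gt1P; exists a, b.
  by split; rewrite ?adj_neq // inE AB ?aA ?bA.
have sH : separation (old A) (old B).
  apply: (@sep_intro _ _ _ x y) => // [z||z t zB tA].
  - exact: cov sAB.
  - by rewrite inE.
  - apply/negP=> /(cross _ _ _ _ sAB zB tA).
    by case/orP=> /andP[_ /eqP tE]; move: tA; rewrite tE ?aA ?bA.
by have := lH _ _ sH; rewrite leqNgt oH.
Qed.

Definition induced (H : sgraph) (A : {set H}) : sgraph := torso A set0.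

Lemma induced_adj (H : sgraph) (A : {set H}) (x y : induced A) :
  adj x y = adj (val x) (val y).
Proof. by rewrite /= /torso_adj !inE !andbF orbF. Qed.

(** * Branching nodes *)

(** Degree at least 2, in a form that survives torsos and contractions. *)
Definition branching (H : sgraph) (x : H) : Prop :=
  exists y z, [/\ adj x y, adj x z & y != z].

(** The nodes outside [A] keep all their neighbours in the torso of [B].  If the
boundary has two nodes x and w, then x is adjacent to w by the virtual edge and
to a node outside [A] by minimality, so only w may fail to branch. *)
Lemma branching_torso (H : sgraph) (A B : {set H}) :
  separation A B -> (#|A :&: B| <= 2)%N -> linked #|A :&: B| H ->
  (forall x, x \notin A -> branching x) ->
  (1 < #|torso B (A :&: B)|)%N /\
  exists w : torso B (A :&: B), forall x, x != w -> branching x.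
Proof.
move=> sAB oAB lAB brB; set X := A :&: B; set TB := torso B X.
have inB x y : adj x y -> x \notin A -> y \in B.
  by move=> xy; apply: (sep_adj (sepC sAB)).
have brT (x : TB) : val x \notin A -> branching x.
  move=> xA; have [y [z [xy xz yz]]] := brB _ xA.
  exists (exist _ y (inB _ _ xy xA) : TB), (exist _ z (inB _ _ xz xA) : TB).
  by split; rewrite -?val_eqE //= /torso_adj /= ?xy ?xz.
have [b bA] := sep_left (sepC sAB).
have bB : b \in B := sep_cover (sepC sAB) bA.
split.
  have [y [z [/= by_ bz yz]]] := brT (exist _ b bB) bA.
  by apply/card_gt1P; exists y, z; split.
(* The exceptional node is a boundary node; without boundary, any will do. *)
have [w wX|X0] := pickP [in X]; last first.
  exists (exist _ b bB) => x _; apply: brT; apply/negP=> xA.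
  by have := X0 (val x); rewrite !inE xA (valP x).
have /setIP[wA wB] := wX.
exists (exist _ w wB) => x; rewrite -val_eqE /= => xw.
have [xA|] := boolP (val x \in A); last exact: brT.
have xX : val x \in X by rewrite inE xA (valP x).
have [c cA xc] := boundary_adj sAB lAB xX.
exists (exist _ w wB : TB), (exist _ c (sep_cover (sepC sAB) cA) : TB).
rewrite -val_eqE /= /torso_adj /= -val_eqE /= xw xX wX orbT xc; split=> //.
by apply: contraNneq cA => <-.
Qed.

(** Such a node has three neighbours in [H].  It loses one at most: either one of
them is u or v, or both are and the merged node replaces them. *)
Lemma branching_contract (H : sgraph) (u v : H) (x : contract u v) :
  linked 3 H -> (3 < #|H|)%N -> x != None -> branching x.
Proof.
case: x => // -[x xuv] lH H3 _.
have := linked_degree x lH H3; set N := [set y | adj x y] => N3.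
have lift2 : (1 < #|N :\: [set u; v]|)%N ->
    branching (Some (exist _ x xuv) : contract u v).
  case/card_gt1P=> y [z [/setDP[+ yuv] /setDP[+ zuv] yz]].
  rewrite !inE => xy xz.
  by exists (Some (exist _ y yuv)), (Some (exist _ z zuv)).
have [/andP[ux vx]|nuvx] := boolP (adj u x && adj v x).
  have : (0 < #|N :\ u :\ v|)%N.
    move: N3; rewrite (cardsD1 u) (cardsD1 v).
    by case: (u \in N) (v \in N :\ u) #|N :\ u :\ v| => [] [] [].
  case/card_gt0P=> z; rewrite !inE => /and3P[zv zu xz].
  have zuv : z \notin [set u; v] by rewrite !inE negb_or zu zv.
  by exists None, (Some (exist _ z zuv)); split=> //=; rewrite ux vx.
apply: lift2; move: N3; rewrite -(cardsID [set u; v] N).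
suff : (#|N :&: [set u; v]| <= 1)%N.
  by case: #|_ :&: _| => [|[|//]] _; rewrite ?add0n ?add1n // => /ltnW.
move: nuvx; rewrite negb_and => /orP[nx|nx].
  rewrite -(cards1 v) subset_leq_card //; apply/subsetP=> y.
  rewrite !inE => /andP[xy /orP[/eqP yu|//]].
  by move: nx; rewrite -yu adj_sym xy.
rewrite -(cards1 u) subset_leq_card //; apply/subsetP=> y.
rewrite !inE => /andP[xy /orP[//|/eqP yu]].
by move: nx; rewrite -yu adj_sym xy.
Qed.

(** * Elementary closure properties *)

Section Property.
Variable Pi : sgraph -> Prop.
Hypotheses (Pi_prop : graph_property Pi)
  (Pi_contract : contraction_hereditary Pi)
  (Pi_comp3 : determined_by_components3 Pi).

(** The splitting rule as an equivalence for Pi itself, free of the lists of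
components. *)
Lemma Pi_split (H : sgraph) (A B : {set H}) :
  separation A B -> (#|A :&: B| <= 2)%N -> linked #|A :&: B| H ->
  Pi H <-> Pi (torso A (A :&: B)) /\ Pi (torso B (A :&: B)).
Proof.
move=> sAB oAB lAB.
have [cs hcs] := components3_exist (torso A (A :&: B)).
have [ds hds] := components3_exist (torso B (A :&: B)).
have hH := Components3_split sAB oAB lAB hcs hds.
rewrite (Pi_comp3 hH) (Pi_comp3 hcs) (Pi_comp3 hds).
exact: List.Forall_app.
Qed.

Lemma Pi_isomorphic (K H : sgraph) (f : K -> H) :
  injective f -> (forall y, y \in codom f) ->
  (forall x y, adj x y = adj (f x) (f y)) -> Pi H <-> Pi K.
Proof.
move=> finj fcodom fadj; have fbij : bijective f.
  exists (fun y => iinv (fcodom y)) => x; last exact: f_iinv.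
  by apply: finj; rewrite f_iinv.
split; apply: Pi_prop; last by exists f.
case: (fbij) => h fK hK; exists h; first by exists f.
by move=> x y; rewrite fadj !hK.
Qed.

Lemma Pi_torso_isomorphic (K H : sgraph) (f : K -> H) (A X : {set H}) :
  injective f -> (forall x, (x \in A) = (x \in codom f)) ->
  (forall x y, adj x y =
     adj (f x) (f y) || [&& x != y, f x \in X & f y \in X]) ->
  Pi (torso A X) <-> Pi K.
Proof.
move=> finj imf fadj.
have fA x : f x \in A by rewrite imf codom_f.
pose g x : torso A X := exist _ (f x) (fA x).
have ginj : injective g by move=> x y [/finj].
apply: (@Pi_isomorphic _ _ g) => // [[y yA]|x y].
  have := yA; rewrite imf => /codomP[x yfx].
  by apply/codomP; exists x; apply: val_inj.
by rewrite fadj /= /torso_adj /= (inj_eq ginj).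
Qed.

(** With at most one boundary node there are no virtual edges, so the torsos
are induced subgraphs. *)
Lemma Pi_split_small (H : sgraph) (A B : {set H}) :
  separation A B -> (#|A :&: B| <= 1)%N -> linked #|A :&: B| H ->
  Pi H <-> Pi (induced A) /\ Pi (induced B).
Proof.
move=> sAB oAB lAB.
have no_virtual C : Pi (torso C (A :&: B)) <-> Pi (induced C).
  pose f (x : induced C) : torso C (A :&: B) := x.
  apply: (@Pi_isomorphic _ _ f) => //.
    by move=> y; apply/codomP; exists y.
  move=> x y; rewrite induced_adj /= /torso_adj.
  case: and3P; rewrite ?orbF // => -[xy xX yX]; case/negP: xy.
  by rewrite -val_eqE /=; apply/eqP; apply: (card_le1_eqP oAB).
rewrite (Pi_split sAB) //; last exact: leq_trans oAB _.
by rewrite !no_virtual.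
Qed.

Lemma Pi_empty (H : sgraph) : #|H| = 0%N -> Pi H.
Proof. by move=> H0; rewrite (Pi_comp3 (Components3_empty H0)). Qed.

(** The image of [f] is a union of connected components of [H], which a
separation of order 0 splits off. *)
Lemma Pi_closed_part (K H : sgraph) (f : K -> H) :
  injective f -> (forall x y, adj x y = adj (f x) (f y)) ->
  (forall x y, x \notin codom f -> ~~ adj x (f y)) -> Pi H -> Pi K.
Proof.
move=> finj fadj fclosed PH.
have [fonto|] := boolP [forall y, y \in codom f].
  by rewrite -(Pi_isomorphic finj) // => y; apply: (forallP fonto).
case/forallPn=> b bf.
have [|] := posnP #|K|; first exact: Pi_empty.
case/card_gt0P=> a _.
pose A := [set y in codom f].
have AP y : (y \in A) = (y \in codom f) by rewrite inE.
have sAB : separation A (~: A).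
  apply: (@sep_intro _ _ _ (f a) b) => [x|||x y].
  - by rewrite inE negbK.
  - by rewrite inE negbK AP codom_f.
  - by rewrite AP.
  - by rewrite !inE negbK => /codomP[z ->] yf; rewrite adj_sym fclosed.
have oAB : #|A :&: ~: A| = 0%N by rewrite setICr cards0.
have lAB : linked #|A :&: ~: A| H by rewrite oAB.
have [+ _] := (Pi_split sAB (leq_trans (eq_leq oAB) isT) lAB).1 PH.
apply: (Pi_torso_isomorphic finj AP _).1 => x y.
by rewrite fadj setICr !inE !andbF orbF.
Qed.

(** Contract edges until some node is isolated. *)
Lemma Pi_single (H K : sgraph) : (0 < #|H|)%N -> #|K| = 1%N -> Pi H -> Pi K.
Proof.
have [n] := ubnP #|H|; elim: n H => // n IHn H; rewrite ltnS => leHn.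
case/card_gt0P=> x _ K1 PH.
have [y xy|nx] := pickP (adj x).
  apply: (IHn (contract x y)) K1 _; last exact: Pi_contract.
    exact: leq_trans (contract_proper (adj_neq xy)) leHn.
  by rewrite card_option.
have /fintype1P[k Kk] := introT eqP K1.
apply: (@Pi_closed_part K H (fun _ => x)) PH => //.
- by move=> a b _; rewrite (Kk a) (Kk b).
- by move=> a b; rewrite nx (Kk a) (Kk b) adj_irr.
- by move=> z _ _; rewrite adj_sym nx.
Qed.

(** * The triangle *)

(** Descent on the number of nodes.  At a separation of least order at most 2, pass
to the torso of the side that does not hold [w] in its interior.  A graph
without such separations is a triangle or has at least four nodes; in the
latter case any contraction leaves all nodes branching but the merged one. *)
Lemma Pi_triangle (H : sgraph) (w : H) :
  (1 < #|H|)%N -> (forall x, x != w -> branching x) -> Pi H -> Pi (complete 3).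
Proof.
have [n] := ubnP #|H|; elim: n H w => // n IHn H w; rewrite ltnS => leHn.
move=> H_gt1 brH PH.
have [lH|[A [B [sAB oAB lAB]]]] := least_separation 3 H; last first.
  wlog wA : A B sAB oAB lAB / w \in A.
    move=> gen; have [wA|wA] := boolP (w \in A); first exact: (gen A B).
    apply: (gen B A); rewrite 1?setIC //; first exact: sepC.
    exact: sep_cover (sepC sAB) wA.
  have brB x : x \notin A -> branching x.
    by move=> xA; apply: brH; apply: contraNneq xA => ->.
  have [TB_gt1 [w' brTB]] := branching_torso sAB oAB lAB brB.
  have [_ PB] := (Pi_split sAB oAB lAB).1 PH.
  apply: IHn brTB PB => //.
  exact: leq_trans (torso_proper _ (sepC sAB)) leHn.
have [z zw] : exists z, z != w.
  case/card_gt1P: H_gt1 => x [y [_ _ xy]].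
  have [xw|] := eqVneq x w; last by exists x.
  by exists y; rewrite -xw eq_sym.
have [y [y' [zy zy' yy']]] := brH z zw.
have [H_le3|H_gt3] := leqP #|H| 3; last first.
  apply: (IHn (contract z y) None); last exact: Pi_contract.
  - exact: leq_trans (contract_proper (adj_neq zy)) leHn.
  - rewrite card_option ltnS; apply/card_gt0P.
    have : (0 < #|~: [set z; y]|)%N.
      have := cardsC [set z; y]; rewrite cards2 (adj_neq zy) => E.
      by move: H_gt3; rewrite -E add2n !ltnS => /(leq_trans _) ->.
    case/card_gt0P=> t tzy.
    have tzy' : t \notin [set z; y] by rewrite -in_setC.
    by exists (exist _ t tzy').
  - by move=> x; apply: branching_contract.
have H3 : #|H| = 3%N.
  apply/eqP; rewrite eqn_leq H_le3 -cardsT; apply/card_gt2P.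
  exists z, y, y'; split; rewrite ?inE //.
  by rewrite (adj_neq zy) yy' eq_sym (adj_neq zy').
have lH2 : linked 2 H by move=> A B /lH /ltnW.
pose f (i : complete 3) : H := enum_val (cast_ord (esym H3) i).
have finj : injective f by move=> i j /enum_val_inj/cast_ord_inj.
rewrite -(@Pi_isomorphic (complete 3) H f) // => [x|i j].
  apply/codomP; exists (cast_ord H3 (enum_rank x)).
  by rewrite /f cast_ordK enum_rankK.
rewrite -[LHS]/(i != j) -(inj_eq finj).
apply/idP/idP => [fij|/adj_neq //].
have := linked_degree (f i) lH2; rewrite H3 => /(_ isT) deg.
have : [set y | adj (f i) y] == [set~ f i].
  rewrite eqEcard cardsC1 H3 deg andbT; apply/subsetP=> x; rewrite !inE eq_sym.
  exact: adj_neq.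
by move/eqP/setP/(_ (f j)); rewrite !inE eq_sym fij.
Qed.

(** * Deleting edges *)

(** The ends of ab form a separation of order 2 of the subdivision; one torso is
[H], with ab as its virtual edge, and the other is a triangle. *)
Lemma Pi_subdivide (H : sgraph) (a b : H) :
  adj a b -> (2 < #|H|)%N -> linked 2 H -> Pi (complete 3) -> Pi H ->
  Pi (subdivide a b).
Proof.
move=> ab H3 lH P3 PH; set K := subdivide a b.
have lK : linked 2 K by apply: subdivide_linked.
have [c /andP[ca cb]] : exists c, (c != a) && (c != b).
  case: (pickP (fun c => (c != a) && (c != b))) => [c|sub]; first by exists c.
  move: H3; rewrite ltnNge => /negP[].
  rewrite -cardsT; apply: leq_trans (_ : #|[set a; b]| <= 2)%N; last first.
    by rewrite cards2; case: (_ != _).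
  apply/subset_leq_card/subsetP=> x _; rewrite !inE.
  by move/negbT: (sub x); rewrite negb_and !negbK.
pose A : {set K} := ~: [set None].
pose B : {set K} := [set None; Some a; Some b].
have AB : A :&: B = [set Some a; Some b].
  by apply/setP=> -[x|]; rewrite !inE.
have sAB : separation A B.
  apply: (@sep_intro K A B (Some c) None).
  - by move=> [x|]; rewrite !inE.
  - by rewrite !inE /= !(inj_eq Some_inj) negb_or ca.
  - by rewrite !inE.
  - move=> [x|] [y|]; rewrite !inE //=.
have oAB : #|A :&: B| = 2%N.
  by rewrite AB cards2 (inj_eq Some_inj) (adj_neq ab).
apply/(Pi_split sAB); rewrite ?oAB //; split.
  apply/(@Pi_torso_isomorphic H K Some) => //; first exact: Some_inj.
    move=> [x|]; rewrite !inE /=; first by rewrite codom_f.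
    by apply/esym/codomP => -[].
  move=> x y; rewrite AB !inE !(inj_eq Some_inj) /=.
  rewrite /delete_adj /same_edge.
  have [xa|xa] := eqVneq x a; have [xb|xb] := eqVneq x b;
  have [ya|ya] := eqVneq y a; have [yb|yb] := eqVneq y b;
  rewrite /= ?andbF ?andbT ?orbF //;
  first [ by rewrite xa ya adj_irr eqxx | by rewrite xb yb adj_irr eqxx
        | by rewrite xa yb ab (adj_neq ab)
        | by rewrite xb ya adj_sym ab eq_sym (adj_neq ab) ].
pose f (i : complete 3) : K := nth None [:: None; Some a; Some b] i.
have a'b : Some a != Some b :> K by rewrite (inj_eq Some_inj) adj_neq.
have finj : injective f.
  move=> i j /eqP; rewrite nth_uniq ?ltn_ord //; first by move/eqP/val_inj.
  by rewrite /= !inE /= a'b.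
apply/(@Pi_torso_isomorphic (complete 3) K f) => // [x|i j].
  apply/idP/codomP => [|[[[|[|[|//]]] i3] ->]]; rewrite !inE ?eqxx ?orbT //.
  case/orP=> [/orP[]|] /eqP->.
  - by exists (Ordinal (isT : 0 < 3)%N).
  - by exists (Ordinal (isT : 1 < 3)%N).
  - by exists (Ordinal (isT : 2 < 3)%N).
rewrite AB !inE -(inj_eq finj) /=.
rewrite -[LHS]/(i != j) -(inj_eq finj).
case: i j => [[|[|[|//]]] i3] [[|[|[|//]]] j3]; rewrite /f /= ?eqxx ?orbT //=.
- by rewrite /delete_adj adj_irr.
- by rewrite a'b orbT.
- by rewrite eq_sym a'b orbT.
- by rewrite /delete_adj adj_irr.
Qed.

(** Subdividing ab twice gives the path a-q-p-b.  Contracting qp makes an isolated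
node, because q and p have no common neighbour, and leaves [H] without ab. *)
Lemma Pi_delete_two_connected (H : sgraph) (a b : H) :
  adj a b -> (2 < #|H|)%N -> linked 2 H -> Pi H -> Pi (delete a b).
Proof.
move=> ab H3 lH PH.
have P3 : Pi (complete 3).
  apply: (@Pi_triangle H a _ _ PH) => [|x _]; first exact: ltnW.
  have /card_gt1P[y [z []]] := linked_degree x lH H3.
  by rewrite !inE => xy xz yz; exists y, z.
pose K := subdivide a b.
have lK : linked 2 K by apply: subdivide_linked.
have PK : Pi K by apply: Pi_subdivide.
have K3 : (2 < #|K|)%N by rewrite card_option ltnW.
have aK : adj (Some a : K) None by rewrite /= eqxx.
pose L := subdivide (Some a : K) None.
have PL : Pi L by apply: Pi_subdivide.
pose q : L := None; pose p : L := Some None.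
have PM : Pi (contract q p) by apply: Pi_contract; rewrite //= eqxx orbT.
have old (x : H) : (Some (Some x) : L) \notin [set q; p] by rewrite !inE.
pose f (x : delete a b) : contract q p :=
  Some (exist (fun z : L => z \notin [set q; p]) _ (old x)).
apply: (@Pi_closed_part _ _ f) PM => [x y|x y|z y].
- by case=> ->.
- by rewrite /= /delete_adj /same_edge /= !andbF orbF andbT.
- case: z => [[[[x|]|] xqp] /codomP[]|_].
  + by exists x; congr Some; apply: val_inj.
  + by exfalso; move: xqp; rewrite !inE.
  + by exfalso; move: xqp; rewrite !inE.
  rewrite /= /delete_adj /same_edge /=.
  rewrite (inj_eq Some_inj) orbF.
  by case: eqP => // ->; rewrite eqxx /= !andbF.
Qed.

(** All edges that leave [C] start at [a].  Hence [a] is a cut vertex that splits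
off [C], unless [C] is reduced to [a]; [b] shows that [C] is not everything. *)
Lemma Pi_bridge_side (H : sgraph) (C : {set H}) (a b : H) :
  linked 1 H -> a \in C -> b \notin C ->
  (forall x y, x \in C -> y \notin C -> adj x y -> x = a) ->
  Pi H -> Pi (induced C).
Proof.
move=> lH aC bC cross PH.
have [/existsP[c /andP[cC ca]]|/existsPn C1] :=
    boolP [exists c, (c \in C) && (c != a)]; last first.
  apply: (Pi_single _ _ PH); first by apply/card_gt0P; exists a.
  rewrite card_sig -(cards1 a); apply: eq_card => x; rewrite !inE.
  apply/idP/eqP => [xC|->//]; apply/eqP.
  by have := C1 x; rewrite xC negbK.
have sAB : separation C (a |: ~: C).
  apply: (@sep_intro _ _ _ c b) => // [x||x y].
  - by rewrite !inE negb_or negbK => /andP[].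
  - by rewrite !inE negb_or ca negbK.
  - rewrite !inE negb_or negbK => /andP[xa xC] yC.
    by apply: contra xa => /(cross _ _ xC yC) ->.
have oAB : #|C :&: (a |: ~: C)| = 1%N.
  rewrite -(cards1 a); apply: eq_card => x; rewrite !inE andb_orr andbN orbF.
  by case: eqP => [->|]; rewrite ?aC ?andbF.
have lAB : linked #|C :&: (a |: ~: C)| H by rewrite oAB.
by have [] := (Pi_split_small sAB (eq_leq oAB) lAB).1 PH.
Qed.

Lemma Pi_delete_inside (H : sgraph) (a b : H) (E : {set H}) :
  ~~ [&& a \in E & b \in E] ->
  Pi (@induced H E) -> Pi (@induced (delete a b) E).
Proof.
move=> abE.
apply: (@Pi_isomorphic _ (@induced H E)
          (fun x : @induced (delete a b) E => x : @induced H E) _ _ _).1 => //.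
  by move=> y; apply/codomP; exists y.
move=> x y; rewrite !induced_adj [LHS]/= /delete_adj.
suff -> : same_edge a b (val x) (val y) = false by rewrite andbT.
apply: contraNF abE => /orP[] /andP[/eqP<- /eqP<-];
  by rewrite (valP x) (valP y).
Qed.

(** Induction on the number of nodes.  A separation of order at most 1 that is of
least order for [H] and for [H] without ab splits both graphs in the same way,
and the induction hypothesis applies to the side that contains ab.  Otherwise
ab is a bridge of a connected graph, or [H] has no separation of order at
most 1. *)
Lemma Pi_delete (H : sgraph) (a b : H) : adj a b -> Pi H -> Pi (delete a b).
Proof.
have [n] := ubnP #|H|; elim: n H a b => // n IHn H a b; rewrite ltnS => leHn.
move=> ab PH; set D := delete a b.
have small_sep (A B : {set H}) : separation A B -> (#|A :&: B| <= 1)%N ->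
    linked #|A :&: B| H -> linked #|A :&: B| D -> Pi D.
  move=> sAB oAB lAB lD.
  wlog [aA bA] : A B sAB oAB lAB lD / a \in A /\ b \in A.
    move=> gen; have [aA|aA] := boolP (a \in A); last first.
      apply: (gen B A); rewrite 1?setIC //; first exact: sepC.
      split; first exact: sep_cover (sepC sAB) aA.
      exact: sep_adj (sepC sAB) ab aA.
    have [bA|bA] := boolP (b \in A); first exact: (gen A B).
    apply: (gen B A); rewrite 1?setIC //; first exact: sepC.
    split; last exact: sep_cover (sepC sAB) bA.
    by apply: sep_adj (sepC sAB) _ bA; rewrite adj_sym.
  have [PA PB] := (Pi_split_small sAB oAB lAB).1 PH.
  apply/(Pi_split_small (separation_delete a b sAB)) => //; split.
    pose a' : induced A := exist _ a aA; pose b' : induced A := exist _ b bA.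
    have PA' : Pi (delete a' b').
      apply: IHn PA; last by rewrite induced_adj.
      exact: leq_trans (torso_proper _ sAB) leHn.
    apply: (@Pi_isomorphic _ (delete a' b')
              (fun x : @induced D A => x : delete a' b') _ _ _).1 PA' => //.
      by move=> y; apply/codomP; exists y.
    by move=> x y; rewrite induced_adj [RHS]/= /delete_adj induced_adj.
  apply: Pi_delete_inside PB; apply: contraL oAB => /andP[aB bB].
  rewrite -ltnNge; apply/card_gt1P; exists a, b.
  by rewrite !inE aA bA aB bB adj_neq.
have [lH1|[A [B [sAB + lAB]]]] := least_separation 1 H; last first.
  rewrite ltnS leqn0 => /eqP oAB.
  by apply: (small_sep A B sAB); rewrite oAB.
(* ab is a bridge: C and its complement are the sides. *)
have [lD1|[C [C' [sCC + _]]]] := least_separation 1 D; last first.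
  rewrite ltnS leqn0 cards_eq0 => /eqP CC0.
  have C'E (x : H) : (x \in C') = (x \notin C).
    apply/idP/idP => [xC'|]; last exact: (@sep_cover D _ _ x (sepC sCC)).
    by apply: contraTN isT => xC; have /setP/(_ x) := CC0; rewrite !inE xC xC'.
  have sDel : separation C (~: C : {set D}).
    by have <- : C' = ~: C by apply/setP=> x; rewrite inE C'E.
  have cross (x y : H) : x \in C -> y \notin C -> adj x y -> same_edge a b x y.
    move=> xC yC xy; apply: contraNT yC => nab.
    by apply: (@sep_adj D _ _ x y sDel); rewrite ?inE ?negbK //= /delete_adj xy.
  have oDel : #|C :&: ~: C| = 0%N by rewrite setICr cards0.
  have lDel : linked #|C :&: ~: C| D by rewrite oDel.
  have separated : (a \in C) != (b \in C).
    apply/negP=> /eqP aCb.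
    have sH : separation (C : {set H}) (~: C).
      case: sDel => h1 h2 h3 _; split=> // x y /setDP[xC _] /setDP[_ yC].
      apply/negP=> /(cross _ _ xC yC).
      case/orP=> /andP[/eqP xE /eqP yE]; move: xC yC; rewrite xE yE aCb.
        by move=> ->.
      by move=> ->.
    by have := lH1 _ _ sH; rewrite setICr cards0.
  have side (E : {set H}) e e' : e \in E -> e' \notin E ->
      (forall x y, x \in E -> y \notin E -> adj x y -> x = e) ->
      ~~ [&& a \in E & b \in E] -> Pi (@induced D E).
    move=> eE e'E crossE abE; apply: Pi_delete_inside abE _.
    exact: Pi_bridge_side lH1 eE e'E crossE PH.
  have abC : ~~ [&& a \in C & b \in C].
    by case: (a \in C) (b \in C) separated => [] [].
  have abC' : ~~ [&& a \in ~: C & b \in ~: C].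
    by rewrite !inE; case: (a \in C) (b \in C) separated => [] [].
  apply/(Pi_split_small sDel _ lDel); first by rewrite oDel.
  have [aC|aC] := boolP (a \in C).
    have bC : b \notin C by move: abC; rewrite aC.
    split; [apply: (side _ a b) => // | apply: (side _ b a) => //];
      rewrite ?inE ?negbK // => x y; rewrite ?inE ?negbK => xC yC xy.
      have /orP[/andP[/eqP//]|/andP[/eqP xb]] := cross _ _ xC yC xy.
      by move: xC; rewrite xb (negPf bC).
    have /orP[/andP[_ /eqP//]|/andP[/eqP yb]] :
      same_edge a b y x by apply: cross; rewrite // adj_sym.
    by move: yC; rewrite yb (negPf bC).
  have bC : b \in C by move: separated; rewrite (negPf aC); case: (b \in C).
  split; [apply: (side _ b a) => // | apply: (side _ a b) => //];
    rewrite ?inE ?negbK // => x y; rewrite ?inE ?negbK => xC yC xy.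
    have /orP[/andP[/eqP xa]|/andP[/eqP//]] := cross _ _ xC yC xy.
    by move: xC; rewrite xa (negPf aC).
  have /orP[/andP[/eqP ya]|/andP[_ /eqP//]] :
    same_edge a b y x by apply: cross; rewrite // adj_sym.
  by move: yC; rewrite ya (negPf aC).
have [lH2|[A [B [sAB oAB lAB]]]] := least_separation 2 H; last first.
  apply: (small_sep A B sAB) => // E F /lD1.
  by apply: leq_trans.
have [H2|H3] := leqP #|H| 2; last exact: Pi_delete_two_connected.
(* H is reduced to a and b, so that deleting ab would disconnect it. *)
have V2 x : x != a -> x = b.
  move=> xa; apply/eqP; apply: contraTT H2 => xb; rewrite -ltnNge.
  rewrite -cardsT; apply/card_gt2P; exists a, b, x.
  by rewrite !inE adj_neq // eq_sym xb xa.
have sD : @separation D [set a] [set b].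
  apply: (@sep_intro D _ _ a b) => [x|||x y]; rewrite !inE ?(adj_neq ab) //.
  - by apply: contraR => /V2->.
  - by rewrite eq_sym (adj_neq ab).
  - move=> xb /V2->; rewrite /= /delete_adj /same_edge eqxx andbT.
    have [->|/V2 xE] := eqVneq x a; first by rewrite andbF.
    by rewrite xE eqxx in xb.
have := lD1 _ _ sD; rewrite card_gt0 => /set0Pn[x]; rewrite !inE.
by case/andP=> /eqP-> /eqP aE; rewrite aE adj_irr in ab.
Qed.

(** Delete the edges of [H] that do not come from [K]; the image of [K] is then a
union of components. *)
Lemma Pi_subgraph (K H : sgraph) (f : K -> H) :
  injective f -> (forall x y, adj x y -> adj (f x) (f y)) -> Pi H -> Pi K.
Proof.
move=> finj; have [n] := ubnP #|[set e : H * H | adj e.1 e.2]|.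
elim: n H f finj => // n IHn H f finj; rewrite ltnS => leHn fadj PH.
pose extra (e : H * H) := adj e.1 e.2 &&
  ~~ [exists x, exists y, [&& adj x y, f x == e.1 & f y == e.2]].
have [[a b] /andP[/= ab nab]|no_extra] := pickP extra; last first.
  have fadjE x y : adj (f x) (f y) ->
      exists x' y', [/\ adj x' y', f x' = f x & f y' = f y].
    move=> xy; have := no_extra (f x, f y); rewrite /extra /= xy /=.
    move/negbFE/existsP=> [x' /existsP[y' /and3P[xy' /eqP fx /eqP fy]]].
    by exists x', y'.
  apply: (Pi_closed_part finj _ _ PH) => [x y|x y xf].
    apply/idP/idP=> [/fadj //|/fadjE[x' [y' [xy' /finj<- /finj<- //]]]].
  apply: contra xf => xy; have := no_extra (x, f y); rewrite /extra /= xy /=.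
  by move/negbFE/existsP=> [x' /existsP[_ /and3P[_ /eqP<- _]]]; apply: codom_f.
apply: (IHn (delete a b) f finj) => [||]; last exact: Pi_delete.
  apply: leq_trans leHn; apply: proper_card; apply/properP; split.
    by apply/subsetP=> -[x y]; rewrite !inE /= => /andP[].
  exists (a, b); rewrite !inE //= /delete_adj /same_edge !eqxx.
  by rewrite andbF.
move=> x y xy; rewrite /= /delete_adj fadj //=; apply: contra nab.
case/orP=> /andP[/eqP<- /eqP<-]; apply/existsP.
  by exists x; apply/existsP; exists y; rewrite xy !eqxx.
by exists y; apply/existsP; exists x; rewrite adj_sym xy !eqxx.
Qed.

End Property.

(** * Contracting several pairs *)

Lemma mergeP (V : finType) (u v x y : V) :
  Defs.merge u v x = Defs.merge u v y ->
  x = y \/ x \in [set u; v] /\ y \in [set u; v].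
Proof.
rewrite /Defs.merge.
have [xuv|xuv] := boolP (x \in [set u; v]);
  have [yuv|yuv] := boolP (y \in [set u; v]); first by right.
- by rewrite insubF ?xuv // insubT.
- by rewrite insubT insubF ?yuv.
- by rewrite !insubT => -[]; left.
Qed.

Lemma merge_ends (V : finType) (u v : V) : Defs.merge u v u = Defs.merge u v v.
Proof. by rewrite /Defs.merge !insubF // !inE eqxx ?orbT. Qed.

(** Two facts about the quotient map of a crisp contraction.  It identifies only
nodes that every map constant on the contracted pairs identifies, which
describes the generated equivalence without constructing it.  And two distinct
classes are adjacent as soon as all pairs of their members are. *)
Lemma contract_along_quotient (V : eqType) (W : Type) (g : V -> W)
    (r : V -> V -> Prop) (s : seq (V * V)) (H : sgraph) (c : V -> H) :
  (forall p, p \in s -> g p.1 = g p.2) ->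
  (forall x y, c x = c y -> g x = g y) ->
  (forall x y, c x != c y ->
     (forall x' y', c x' = c x -> c y' = c y -> r x' y') -> adj (c x) (c y)) ->
  exists d : V -> contract_along s c,
    (forall x y, d x = d y -> g x = g y) /\
    (forall x y, d x != d y ->
      (forall x' y', d x' = d x -> d y' = d y -> r x' y') -> adj (d x) (d y)).
Proof.
elim: s H c => [|[u v] s IHs] H c gs gc adjc /=; first by exists c.
have {gs} [guv gs] : g u = g v /\ forall p, p \in s -> g p.1 = g p.2.
  split=> [|p ps]; first by apply: (gs (u, v)); rewrite in_cons eqxx.
  by apply: gs; rewrite in_cons ps orbT.
case: ifP => [_|/negbT cuv]; first exact: IHs.
apply: IHs => // [x y /mergeP[/gc //|[]]|].
  have gend z : c z \in [set c u; c v] -> g z = g u.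
    by rewrite !inE => /orP[] /eqP/gc // ->.
  by move=> /gend-> /gend->.
set m := Defs.merge (c u) (c v).
have m_in z : c z \in [set c u; c v] -> m (c z) = None.
  by move=> zuv; rewrite /m /Defs.merge insubF ?zuv.
have old z (zuv : c z \notin [set c u; c v]) :
  m (c z) = Some (exist _ (c z) zuv) by rewrite /m /Defs.merge insubT.
have muv z : c z = c u \/ c z = c v -> m (c z) = None.
  by move=> zuv; apply: m_in; rewrite !inE; case: zuv => ->; rewrite eqxx ?orbT.
have cross x y (yuv : c y \notin [set c u; c v]) :
    c x \in [set c u; c v] ->
    (forall x' y', m (c x') = m (c x) -> m (c y') = m (c y) -> r x' y') ->
    adj (c u) (c y) && adj (c v) (c y).
  move=> xuv rxy; move: (yuv); rewrite !inE negb_or => /andP[yu yv].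
  apply/andP; split; apply: adjc; rewrite 1?eq_sym // => x' y' x'E y'E;
    apply: rxy;
    by rewrite ?y'E // (m_in x) // muv; auto.
move=> x y; have [xuv|xuv] := boolP (c x \in [set c u; c v]);
  have [yuv|yuv] := boolP (c y \in [set c u; c v]).
- by rewrite (m_in x) // (m_in y).
- by move=> _ /(cross x y yuv xuv); rewrite (m_in x) // (old _ yuv).
- move=> _ rxy; rewrite (m_in y) // (old _ xuv) /=.
  move: (xuv); rewrite !inE negb_or => /andP[xu xv].
  apply/andP; split; rewrite adj_sym; apply: adjc => // x' y' x'E y'E;
    apply: rxy;
    by rewrite ?x'E // (m_in y) // muv; auto.
- move=> mxy rxy; rewrite (old _ xuv) (old _ yuv) /=.
  apply: adjc => [|x' y' x'E y'E]; last by apply: rxy; rewrite ?x'E ?y'E.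
  by apply: contra mxy => /eqP->.
Qed.

Lemma tnorm_le_args (R : realType) (T : tnorm R) (a b : R) :
  in01 a -> in01 b -> (T a b <= a) && (T a b <= b).
Proof.
by move=> a01 b01; have := tnorm_le_min T a01 b01; rewrite /= le_min.
Qed.

(** The counterpart for fuzzy contraction, in the opposite direction: the pairs are
identified, and a membership in the quotient that reaches [alpha] forces the
memberships of all the representatives to reach it.  Positivity of [alpha]
disposes of the zero membership of a loop at the merged node. *)
Lemma fcontract_along_quotient (R : realType) (T S : tnorm R)
    (TS : tnorm_le T S) (alpha : R) (alpha_gt0 : 0 < alpha) (V : eqType)
    (mV : V -> R) (mE : V -> V -> R) (s : seq (V * V))
    (G : fuzzy_graph R) (c : V -> G) :
  (forall a, exists x, c x = a) ->
  (forall x, alpha <= muV (c x) -> alpha <= mV x) ->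
  (forall x y, alpha <= muE (c x) (c y) -> alpha <= mE x y) ->
  exists d : V -> fcontract_along TS s c,
    [/\ forall a, exists x, d x = a,
        forall x y, c x = c y -> d x = d y,
        forall p, p \in s -> d p.1 = d p.2,
        forall x, alpha <= muV (d x) -> alpha <= mV x &
        forall x y, alpha <= muE (d x) (d y) -> alpha <= mE x y].
Proof.
elim: s G c => [|[u v] s IHs] G c csurj cV cE /=; first by exists c; split.
case: ifP => [/eqP cuv|/negbT cuv].
  have [d [dsurj dc ds dV dE]] := IHs G c csurj cV cE.
  exists d; split=> // p; rewrite in_cons => /orP[/eqP->|/ds//].
  exact: dc.
set m := Defs.merge (c u) (c v).
have m_out z (zuv : c z \notin [set c u; c v]) :
  m (c z) = Some (exist _ (c z) zuv) by rewrite /m /Defs.merge insubT.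
have m_in z : c z \in [set c u; c v] -> m (c z) = None.
  by move=> zuv; rewrite /m /Defs.merge insubF ?zuv.
have T_ge a b a' b' : alpha <= T (muE a b : R) (muE a' b' : R) ->
    alpha <= muE a b /\ alpha <= muE a' b' :> R.
  have /andP[Ta Tb] := tnorm_le_args T (muE_in01 a b) (muE_in01 a' b').
  by move=> aT; split; apply: le_trans aT _.
have [|||d [dsurj dc ds dV dE]] :=
  IHs (fcontract TS (c u) (c v)) (fun z => m (c z)).
- case=> [[a auv]|]; last by exists u; rewrite m_in // !inE eqxx.
  have [x xa] := csurj a; exists x; rewrite -xa in auv *.
  exact: m_out.
- move=> x; have [xuv|xuv] := boolP (c x \in [set c u; c v]); last first.
    by rewrite (m_out _ xuv) /=; apply: cV.
  rewrite (m_in _ xuv) /= => aS; apply: cV; apply: le_trans aS _.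
  have /andP[Su Sv] := tnorm_le_args S (muV_in01 (c u)) (muV_in01 (c v)).
  by move: xuv; rewrite !inE => /orP[] /eqP->.
- move=> x y; have [xuv|xuv] := boolP (c x \in [set c u; c v]);
    have [yuv|yuv] := boolP (c y \in [set c u; c v]).
  + by rewrite (m_in _ xuv) (m_in _ yuv) /= leNgt alpha_gt0.
  + rewrite (m_in _ xuv) (m_out _ yuv) /= => /T_ge[uy vy]; apply: cE.
    by move: xuv; rewrite !inE => /orP[] /eqP->.
  + rewrite (m_out _ xuv) (m_in _ yuv) /= => /T_ge[ux vx].
    apply: cE; rewrite muE_sym.
    by move: yuv; rewrite !inE => /orP[] /eqP->.
  + by rewrite (m_out _ xuv) (m_out _ yuv) /=; apply: cE.
exists d; split=> // [x y cxy|p]; first by apply: dc; rewrite cxy.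
rewrite in_cons => /orP[/eqP->|/ds//]; apply: dc; exact: merge_ends.
Qed.

Theorem theorem3p5 (R : realType) (Pi : sgraph -> Prop)
    (Pi_prop : graph_property Pi)
    (Pi_contract : contraction_hereditary Pi)
    (Pi_comp3 : determined_by_components3 Pi)
    (T S : tnorm R) (TS : tnorm_le T S)
    (G : fuzzy_graph R) (alpha : R) (alpha01 : 0 < alpha <= 1)
    (F : {set {set cut G alpha}}) (F_edges : F \subset edges (cut G alpha))
    (s : seq (cut G alpha * cut G alpha)) (s_F : enumerates s F)
    (t : seq (G * G))
    (t_F : enumerates t [set [set cut_val x | x in e] | e : {set cut G alpha} in F]) :
  Pi (contract_seq s) -> Pi (cut (fcontract_seq TS t) alpha).
Proof.
have /andP[alpha_gt0 _] := alpha01.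
have [d [dsurj _ dt dV dE]] :=
  @fcontract_along_quotient R T S TS alpha alpha_gt0 G (@muV R G) (@muE R G)
    t G id
    (fun a => ex_intro _ a erefl) (fun _ h => h) (fun _ _ h => h).
have ds p : p \in s -> d (cut_val p.1) = d (cut_val p.2).
  move=> ps; pose e := [set p.1; p.2].
  have eF : e \in F.
    by rewrite -mem_enum -(perm_mem s_F); apply: map_f ps.
  have : [set cut_val x | x in e] \in [seq [set q.1; q.2] | q <- t].
    by rewrite (perm_mem t_F) mem_enum imset_f.
  case/mapP=> q /dt dq eq_e.
  have de x : x \in e -> d (cut_val x) = d q.1.
    by move/(imset_f (@cut_val _ _ _)); rewrite eq_e in_set2 => /orP[] /eqP->.
  by rewrite (de p.1) ?(de p.2) // !inE eqxx ?orbT.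
have [c [cd cadj]] := @contract_along_quotient (cut G alpha) _
  (fun x => d (cut_val x)) (fun x y => adj x y) s (cut G alpha) id ds
  (congr1 (fun z => d (cut_val z)))
  (fun x y _ h => h x y erefl erefl).
(* A node of the cut of G/F is sent to the class of any representative. *)
have rep (k : cut (fcontract_seq TS t) alpha) :
    exists x : cut G alpha, d (cut_val x) == cut_val k.
  have [x dx] := dsurj (cut_val k).
  have xa : alpha <= muV x by apply: dV; rewrite dx; apply: (valP k).
  by exists (exist _ x xa); rewrite /cut_val /= dx.
pose f k := c (xchoose (rep k)).
have fP k : d (cut_val (xchoose (rep k))) = cut_val k.
  exact/eqP/(xchooseP (rep k)).
have finj : injective f.
  by move=> k l /cd; rewrite !fP => /val_inj.
apply: (Pi_subgraph Pi_prop Pi_contract Pi_comp3 finj) => k l kl.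
apply: cadj => [|x y xk yl]; first by rewrite (inj_eq finj) adj_neq.
case/andP: kl => kl_neq kl.
have xd : d (cut_val x) = cut_val k by rewrite (cd _ _ xk) fP.
have yd : d (cut_val y) = cut_val l by rewrite (cd _ _ yl) fP.
apply/andP; split; last by apply: dE; rewrite -/(cut_val _) xd -/(cut_val y) yd.
apply: contra kl_neq => /eqP xy; apply/eqP/val_inj.
by rewrite -/(cut_val _) -xd xy.
Qed.
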